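(* Let $\mathcal P$ be an operad over the field $\Bbbk$ (not necessarily unitary) and let $A$ be an algebra over $\mathcal P$. Suppose $A$ is generated by $g$ elements (as an algebra over $\mathcal P$). Then $$\operatorname{GKdim}A\le g-1+\operatorname{GKdim}\mathcal P.$$
   Context: Fix a field $\Bbbk$; operads are $\Bbbk$-linear symmetric operads (right $\mathbb S_n$-action on $\mathcal P(n)$, identity $\mathbf 1\in\mathcal P(1)$, compositions with the usual unit, associativity and equivariance axioms). An algebra over $\mathcal P$ is a vector space $A$ with an operad morphism $\gamma$ from $\mathcal P$ to the endomorphism operad $\operatorname{End}_A$, $\operatorname{End}_A(n)=\operatorname{Hom}_\Bbbk(A^{\otimes n},A)$. For a subset (or subspace) $X\subseteq A$, $\gamma_n(X)$ denotes the image of $\mathcal P(n)\otimes(\Bbbk X)^{\otimes n}\to A$, where $\Bbbk X$ is the span of $X$. $X$ is a set of generators of $A$ if $A=\sum_{n\ge0}\gamma_n(X)$; $A$ is generated by $g$ elements if it has a set of generators with $g$ elements. The GKdimension of $A$ is $$\operatorname{GKdim}(A)=\sup_V\Big\{\limsup_{n\to\infty}\log_n\Big(\dim_\Bbbk\sum_{i=0}^n\gamma_i(V)\Big)\Big\},$$ the supremum over all finite dimensional subspaces $V\subseteq A$. $\operatorname{GKdim}\mathcal P=\limsup_{n\to\infty}\log_n\big(\sum_{i=0}^n\dim_\Bbbk\mathcal P(i)\big)$; when GKdimension is discussed, $\mathcal P$ is implicitly assumed locally finite ($\dim_\Bbbk\mathcal P(n)<\infty$ for all $n$).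
   Formalization: The number of generators g is assumed to be at least 1; for g = 0 the inequality fails, e.g. P(0) = P(1) = k with all other components zero and A = k the image of P(0), where GKdim A = 0 but g − 1 + GKdim P = −1. *)

(* Defs.v *)
From HB Require Import structures.
From mathcomp Require Import all_boot all_order all_algebra all_fingroup.
From mathcomp Require Import all_classical all_reals all_analysis.

Set Implicit Arguments.
Unset Strict Implicit.
Unset Printing Implicit Defensive.

Import Order.TTheory GRing.Theory Num.Theory.
Local Open Scope classical_set_scope.
Local Open Scope ring_scope.

Definition multilinear (K : fieldType) (I : eqType) (V : I -> lmodType K)
    (W : lmodType K) (f : (forall i, V i) -> W) : Prop :=
  forall (x : forall i, V i) (i : I),
    linear (fun u : V i => f (eqtype.dfwith x u)).

(* Arities of composites. An input of a composite with blocks of sizes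
   k 0, ..., k (n - 1) is an element of 'I_(\sum_i k i); tagnat.Rank i j is the
   j-th input of the i-th block (in lexicographic order), and
   u |-> (tagnat.sig1 u, tagnat.sig2 u) is the inverse bijection. *)

Lemma sum_arity_unitl (n : nat) : (\sum_(i < 1) n = n)%N.
Proof. exact: big_ord1. Qed.

Lemma sum_arity_unitr (n : nat) : (\sum_(i < n) 1 = n)%N.
Proof. by rewrite sum1_card card_ord. Qed.

Lemma sum_arity_assoc (n : nat) (k : 'I_n -> nat)
    (l : forall i, 'I_(k i) -> nat) :
  (\sum_(i < n) \sum_(j < k i) l i j =
   \sum_(u < \sum_(i < n) k i) l (tagnat.sig1 u) (tagnat.sig2 u))%N.
Proof.
pose F (p : {i & 'I_(k i)}) : nat := l (tag p) (tagged p).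
rewrite (sig_big_dep (fun=> true) (fun _ => fun=> true) l) /=.
by rewrite (reindex _ (tagnat.sig_bij_on)).
Qed.

Lemma sum_arity_perm (n : nat) (k : 'I_n -> nat) (s : 'S_n) :
  (\sum_(i < n) k (s i) = \sum_(i < n) k i)%N.
Proof. by rewrite [RHS](reindex_inj (@perm_inj _ s)). Qed.

Lemma tagnat_ltn_rank (n : nat) (k : 'I_n -> nat) (q : {i & 'I_(k i)})
    (i : 'I_n) (j : 'I_(k i)) :
  (tagnat.rank q < tagnat.Rank i j)%N =
  (tag q < i)%N || ((tag q == i) && (tagged q < j)%N).
Proof.
have := tagnat.lt_rank q (Tagged (fun i => 'I_(k i)) j); rewrite ltEord => ->.
case: q => i' j'; rewrite ltEsig /= !leEord; case: ltngtP => //=.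
  by move=> lt_i; case: eqP => // ei; rewrite ei ltnn in lt_i.
by move=> /val_inj ei; subst i'; rewrite eqxx tagged_asE ltEord.
Qed.

Lemma tagnat_Rank_assoc (n : nat) (k : 'I_n -> nat)
    (l : forall i, 'I_(k i) -> nat) (u : 'I_(\sum_(i < n) k i))
    (p : 'I_(l (tagnat.sig1 u) (tagnat.sig2 u))) :
  tagnat.Rank (p_ := fun u => l (tagnat.sig1 u) (tagnat.sig2 u)) u p =
  tagnat.Rank (p_ := fun i => (\sum_j l i j)%N) (tagnat.sig1 u)
    (tagnat.Rank (tagnat.sig2 u) p) :> nat.
Proof.
rewrite [LHS]tagnat.rankEsum [RHS]tagnat.rankEsum /=.
rewrite [X in (_ = _ + X)%N]tagnat.rankEsum /= addnA; congr (_ + _)%N.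
set i0 := tagnat.sig1 u; set j0 := tagnat.sig2 u.
have lt_u (q : {i & 'I_(k i)}) : (tagnat.rank q < u)%N =
    (tag q < i0)%N || ((tag q == i0) && (tagged q < j0)%N).
  by rewrite -[u in LHS](tagnat.sig2K u) tagnat_ltn_rank.
pose F (q : {i & 'I_(k i)}) := l (tag q) (tagged q).
rewrite (reindex _ (onW_bij _ tagnat.rank_bij)) /=.
rewrite (eq_big (fun q : {i & 'I_(k i)} => (tag q < i0)%N ||
                   ((tag q == i0) && (tagged q < j0)%N)) F)
  => [||q _]; [|exact: lt_u|by rewrite /F /tagnat.sig1 /tagnat.sig2 tagnat.rankK].
pose Q i (j : 'I_(k i)) := (i < i0)%N || ((i == i0) && (j < j0)%N).
rewrite -(sig_big_dep (fun=> true) Q l) /=.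
rewrite (bigID (fun i : 'I_n => (i < i0)%N)) /=; congr (_ + _)%N.
  by apply: eq_bigr => i lt_i; apply: eq_bigl => j; rewrite /Q lt_i.
rewrite (bigD1 i0) ?ltnn //= [X in (_ + X)%N]big1 ?addn0 => [|i /andP[ge_i ne_i]].
  by apply: eq_bigl => j; rewrite /Q ltnn eqxx.
by rewrite big_pred0 // => j; rewrite /Q (negbTE ge_i) (negbTE ne_i).
Qed.

Section BlockPermutations.
Variables (n : nat) (k : 'I_n -> nat).

(* The block sum of the permutations t i. *)
Definition block_sum_fun (t : forall i, 'S_(k i))
    (u : 'I_(\sum_(i < n) k i)) : 'I_(\sum_(i < n) k i) :=
  tagnat.Rank (tagnat.sig1 u) (t (tagnat.sig1 u) (tagnat.sig2 u)).

Lemma block_sum_inj t : injective (block_sum_fun t).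
Proof.
move=> u v /tagnat.rank_inj; rewrite -[u]tagnat.sigK -[v]tagnat.sigK.
rewrite /tagnat.sig1 /tagnat.sig2 !tagnat.rankK.
case: (tagnat.sig u) (tagnat.sig v) => [i a] [j b] /= E.
have Eij : i = j by case: E.
subst j; congr (tagnat.rank _).
by move/eqP: E; rewrite eq_Tagged => /eqP /perm_inj ->.
Qed.

Definition block_sum (t : forall i, 'S_(k i)) : 'S_(\sum_(i < n) k i) :=
  perm (@block_sum_inj t).

(* The permutation of the n blocks, of sizes k 0, ..., k (n - 1), induced by s:
   it sends the j-th input of the i-th block, for the sizes k (s 0), ...,
   k (s (n - 1)), to the j-th input of the (s i)-th block, for the sizes
   k 0, ..., k (n - 1). *)
Definition block_perm_fun (s : 'S_n) (u : 'I_(\sum_(i < n) k i)) :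
    'I_(\sum_(i < n) k i) :=
  let u' : 'I_(\sum_(i < n) k (s i)) := cast_ord (esym (sum_arity_perm k s)) u in
  tagnat.Rank (s (tagnat.sig1 u')) (tagnat.sig2 u' : 'I_(k _)).

Lemma block_perm_inj s : injective (block_perm_fun s).
Proof.
move=> u v /tagnat.rank_inj.
set u' := cast_ord _ u; set v' := cast_ord _ v => E.
suff : u' = v' by apply: cast_ord_inj.
move: E; rewrite -[u']tagnat.sigK -[v']tagnat.sigK.
rewrite /tagnat.sig1 /tagnat.sig2 !tagnat.rankK.
case: (tagnat.sig u') (tagnat.sig v') => [i a] [j b] /= E.
have Eij : i = j by case: E => /perm_inj.
subst j; congr (tagnat.rank _).
by move/eqP: E; rewrite eq_Tagged => /eqP /= ->.
Qed.

Definition block_perm (s : 'S_n) : 'S_(\sum_(i < n) k i) :=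
  perm (@block_perm_inj s).

End BlockPermutations.

(* K-linear symmetric operads. The actions are right actions of the group 'S_n,
   whose product is diagrammatic: (s * t) i = t (s i). *)
Record operad (K : fieldType) := Operad {
  op_space :> nat -> lmodType K;
  op_id : op_space 1%N;
  op_act : forall n, op_space n -> 'S_n -> op_space n;
  op_comp : forall n (k : 'I_n -> nat),
    op_space n -> (forall i, op_space (k i)) -> op_space (\sum_(i < n) k i)%N;
  op_act_linear : forall n (s : 'S_n), linear (fun x => op_act x s);
  op_act1 : forall n (x : op_space n), op_act x 1%g = x;
  op_actM : forall n (x : op_space n) (s t : 'S_n),
    op_act x (s * t)%g = op_act (op_act x s) t;
  op_comp_linear : forall n (k : 'I_n -> nat) (y : forall i, op_space (k i)),
    linear (fun x => op_comp x y);
  op_comp_multilinear : forall n (k : 'I_n -> nat) (x : op_space n),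
    multilinear (fun y : forall i, op_space (k i) => op_comp x y);
  op_unitl : forall n (x : op_space n),
    ecast m (op_space m) (sum_arity_unitl n)
      (op_comp (k := fun=> n) op_id (fun=> x)) = x;
  op_unitr : forall n (x : op_space n),
    ecast m (op_space m) (sum_arity_unitr n)
      (op_comp (k := fun=> 1%N) x (fun=> op_id)) = x;
  op_assoc : forall n (k : 'I_n -> nat) (l : forall i, 'I_(k i) -> nat)
      (x : op_space n) (y : forall i, op_space (k i))
      (z : forall i (j : 'I_(k i)), op_space (l i j)),
    ecast m (op_space m) (sum_arity_assoc l)
      (op_comp x (fun i => op_comp (y i) (z i))) =
    op_comp (op_comp x y) (fun u => z (tagnat.sig1 u) (tagnat.sig2 u));
  op_equivariant_inner : forall n (k : 'I_n -> nat) (x : op_space n)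
      (y : forall i, op_space (k i)) (t : forall i, 'S_(k i)),
    op_comp x (fun i => op_act (y i) (t i)) =
    op_act (op_comp x y) (block_sum t);
  op_equivariant_outer : forall n (k : 'I_n -> nat) (x : op_space n)
      (y : forall i, op_space (k i)) (s : 'S_n),
    op_comp (op_act x s) y =
    op_act (ecast m (op_space m) (sum_arity_perm k s)
              (op_comp x (fun i => y (s i))))
           (block_perm k s)
}.

Record operad_hom (K : fieldType) (P Q : operad K) := OperadHom {
  hom_fun :> forall n, {linear P n -> Q n};
  hom_id : hom_fun 1%N (op_id P) = op_id Q;
  hom_act : forall n (x : P n) (s : 'S_n),
    hom_fun n (op_act x s) = op_act (hom_fun n x) s;
  hom_comp : forall n (k : 'I_n -> nat) (x : P n) (y : forall i, P (k i)),
    hom_fun _ (op_comp x y) = op_comp (hom_fun n x) (fun i => hom_fun (k i) (y i))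
}.

(* Hom(A^{\otimes n}, A), as the space of n-multilinear maps. *)
Section MultilinearMaps.
Variables (K : fieldType) (A : lmodType K) (n : nat).

Definition multilinear_pred : {pred (('I_n -> A) -> A)} :=
  fun f => `[< multilinear f >].

Lemma multilinear_submod_closed : submod_closed multilinear_pred.
Proof.
split=> [|a f g /asboolP mf /asboolP mg].
  by apply/asboolP => x i c u v; rewrite scaler0 addr0.
apply/asboolP => x i c u v.
have E w : (a *: f + g) w = a *: f w + g w by [].
rewrite !E mf mg !scalerDr !scalerA mulrC -!addrA.
by congr (_ + _); rewrite addrCA.
Qed.

HB.instance Definition _ :=
  GRing.isSubmodClosed.Build K (('I_n -> A) -> A) multilinear_pred
    multilinear_submod_closed.

Record multihom := Multihom {
  multihom_fun :> ('I_n -> A) -> A;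
  multihomP : multihom_fun \in multilinear_pred
}.

HB.instance Definition _ := [isSub for multihom_fun].
HB.instance Definition _ := [Choice of multihom by <:].
HB.instance Definition _ := [SubChoice_isSubLmodule of multihom by <:].

End MultilinearMaps.

Section EndomorphismOperad.
Variables (K : fieldType) (A : lmodType K).

Lemma multihom_linear n (f : multihom A n) : multilinear f.
Proof. by case: f => f /= /asboolP. Qed.

Lemma multihom_ext n (f g : multihom A n) : (forall v, f v = g v) -> f = g.
Proof. by move=> fg; apply: val_inj; apply: funext. Qed.

Lemma multihom_lin n a (f g : multihom A n) v : (a *: f + g) v = a *: f v + g v.
Proof. by []. Qed.

Lemma multihom_cast m n (e : m = n) (f : multihom A m) v :
  ecast i (multihom A i) e f v = f (fun i => v (cast_ord e i)).
Proof.
by case: _ / e v => v; congr (f _); apply: funext => i; rewrite cast_ord_id.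
Qed.

Lemma id_multilinear :
  (fun v : 'I_1 -> A => v ord0) \in @multilinear_pred K A 1.
Proof.
by apply/asboolP => x i a u v; rewrite (ord1 i) !eqtype.dfwith_in.
Qed.

Lemma act_multilinear n (f : multihom A n) (s : 'S_n) :
  (fun v => f (fun i => v (s i))) \in @multilinear_pred K A n.
Proof.
apply/asboolP => x i a u v.
have E (w : A) : (fun j => eqtype.dfwith x w (i := i) (s j)) =
    eqtype.dfwith (fun j => x (s j)) w (i := (s^-1)%g i).
  apply: funext => j; case: (eqVneq ((s^-1)%g i) j) => [<-|ne].
    by rewrite permKV !eqtype.dfwith_in.
  rewrite !eqtype.dfwith_out //; apply: contra_neq ne => ->.
  by rewrite permK.
by rewrite !E multihom_linear.
Qed.

Lemma comp_multilinear n (k : 'I_n -> nat) (f : multihom A n)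
    (g : forall i, multihom A (k i)) :
  (fun v => f (fun i => g i (fun j => v (tagnat.Rank i j))))
    \in @multilinear_pred K A (\sum_(i < n) k i)%N.
Proof.
apply/asboolP => x p a u v; rewrite -(tagnat.sig2K p).
set i0 := tagnat.sig1 p; set j0 := tagnat.sig2 p.
have E (w : A) : (fun i => g i (fun j =>
       eqtype.dfwith x w (i := tagnat.Rank i0 j0) (tagnat.Rank i j))) =
    eqtype.dfwith (fun i => g i (fun j => x (tagnat.Rank i j)))
      (i := i0) (g i0 (eqtype.dfwith (fun j => x (tagnat.Rank i0 j)) w (i := j0))).
  apply: funext => i; case: (eqVneq i0 i) => [<-|ne].
    rewrite eqtype.dfwith_in; congr (g i0 _); apply: funext => j.
    case: (eqVneq j0 j) => [<-|nej]; first by rewrite !eqtype.dfwith_in.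
    rewrite !eqtype.dfwith_out // -val_eqE tagnat.eq_Rank eqxx /=.
    by rewrite val_eqE.
  rewrite eqtype.dfwith_out //; congr (g i _); apply: funext => j.
  by rewrite eqtype.dfwith_out // -val_eqE tagnat.eq_Rank (negbTE ne).
by rewrite !E !multihom_linear.
Qed.

Definition end_id : multihom A 1 := Multihom id_multilinear.

Definition end_act n (f : multihom A n) (s : 'S_n) : multihom A n :=
  Multihom (act_multilinear f s).

Definition end_comp n (k : 'I_n -> nat) (f : multihom A n)
    (g : forall i, multihom A (k i)) : multihom A (\sum_(i < n) k i)%N :=
  Multihom (comp_multilinear f g).

Lemma end_act_linear n (s : 'S_n) : linear (fun f : multihom A n => end_act f s).
Proof. by move=> a f g; apply: multihom_ext. Qed.

Lemma end_act1 n (f : multihom A n) : end_act f 1%g = f.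
Proof.
apply: multihom_ext => v; congr (f _); apply: funext => i; by rewrite perm1.
Qed.

Lemma end_actM n (f : multihom A n) (s t : 'S_n) :
  end_act f (s * t)%g = end_act (end_act f s) t.
Proof.
apply: multihom_ext => v; congr (f _); apply: funext => i; by rewrite permM.
Qed.

Lemma end_comp_linear n (k : 'I_n -> nat) (g : forall i, multihom A (k i)) :
  linear (fun f : multihom A n => end_comp f g).
Proof. by move=> a f f'; apply: multihom_ext. Qed.

Lemma end_comp_multilinear n (k : 'I_n -> nat) (f : multihom A n) :
  multilinear (fun g : forall i, multihom A (k i) => end_comp f g).
Proof.
move=> g i0 a h h'; apply: multihom_ext => v; rewrite multihom_lin /=.
have E (w : multihom A (k i0)) :
    (fun i => eqtype.dfwith g w i (fun j => v (tagnat.Rank i j))) =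
    eqtype.dfwith (fun i => g i (fun j => v (tagnat.Rank i j)))
      (i := i0) (w (fun j => v (tagnat.Rank i0 j))).
  apply: funext => i; case: (eqVneq i0 i) => [<-|ne].
    by rewrite !eqtype.dfwith_in.
  by rewrite !eqtype.dfwith_out.
by rewrite !E multihom_lin multihom_linear.
Qed.

Lemma end_unitl n (f : multihom A n) :
  ecast m (multihom A m) (sum_arity_unitl n)
    (end_comp (k := fun=> n) end_id (fun=> f)) = f.
Proof.
apply: multihom_ext => v; rewrite multihom_cast /=; congr (f _).
apply: funext => i; congr (v _); apply: val_inj.
apply: (etrans (tagnat.rankEsum _)) => /=.
by rewrite big_pred0 // => j; rewrite (ord1 j).
Qed.

Lemma end_unitr n (f : multihom A n) :
  ecast m (multihom A m) (sum_arity_unitr n)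
    (end_comp (k := fun=> 1%N) f (fun=> end_id)) = f.
Proof.
apply: multihom_ext => v; rewrite multihom_cast /=; congr (f _).
apply: funext => i; congr (v _); apply: val_inj.
apply: (etrans (tagnat.rankEsum _)) => /=; rewrite addn0.
by rewrite (big_ord_narrow (ltnW (ltn_ord i))) sum1_card card_ord.
Qed.

Lemma end_assoc n (k : 'I_n -> nat) (l : forall i, 'I_(k i) -> nat)
    (f : multihom A n) (g : forall i, multihom A (k i))
    (h : forall i (j : 'I_(k i)), multihom A (l i j)) :
  ecast m (multihom A m) (sum_arity_assoc l)
    (end_comp f (fun i => end_comp (g i) (h i))) =
  end_comp (end_comp f g) (fun u => h (tagnat.sig1 u) (tagnat.sig2 u)).
Proof.
apply: multihom_ext => v; rewrite multihom_cast /=; congr (f _).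
apply: funext => i; congr (g i _); apply: funext => j.
pose Q (q : {i & 'I_(k i)}) := h (tag q) (tagged q) (fun p =>
  v (cast_ord (sum_arity_assoc l)
       (tagnat.Rank (p_ := fun i => (\sum_j l i j)%N) (tag q)
          (tagnat.Rank (tagged q) p)))).
rewrite [LHS](_ : _ = Q (Tagged _ j)) // -(tagnat.rankK (Tagged _ j)) /Q.
congr (h _ _ _); apply: funext => p; congr (v _); apply: val_inj.
exact/esym/tagnat_Rank_assoc.
Qed.

Lemma end_equivariant_inner n (k : 'I_n -> nat) (f : multihom A n)
    (g : forall i, multihom A (k i)) (t : forall i, 'S_(k i)) :
  end_comp f (fun i => end_act (g i) (t i)) =
  end_act (end_comp f g) (block_sum t).
Proof.
apply: multihom_ext => v; congr (f _); apply: funext => i.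
congr (g i _); apply: funext => j; congr (v _).
rewrite permE /block_sum_fun /tagnat.sig1 /tagnat.sig2.
by rewrite /tagnat.Rank tagnat.rankK.
Qed.

Lemma end_equivariant_outer n (k : 'I_n -> nat) (f : multihom A n)
    (g : forall i, multihom A (k i)) (s : 'S_n) :
  end_comp (end_act f s) g =
  end_act (ecast m (multihom A m) (sum_arity_perm k s)
             (end_comp f (fun i => g (s i))))
          (block_perm k s).
Proof.
apply: multihom_ext => v; rewrite /= multihom_cast; congr (f _).
apply: funext => i; congr (g _ _); apply: funext => j; congr (v _).
rewrite permE /block_perm_fun /= cast_ordK /tagnat.sig1 /tagnat.sig2.
by rewrite /tagnat.Rank tagnat.rankK.
Qed.

Definition end_operad : operad K := Operad
  end_act_linear end_act1 end_actM end_comp_linear end_comp_multilinear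
  end_unitl end_unitr end_assoc end_equivariant_inner end_equivariant_outer.

End EndomorphismOperad.

(* An algebra over P with underlying vector space A. *)
Definition algebra_over (K : fieldType) (P : operad K) (A : lmodType K) :=
  operad_hom P (end_operad A).

Section LinearAlgebra.
Variables (K : fieldType) (V : lmodType K).

Definition lin_span (X : set V) : set V :=
  [set v | exists n (c : 'I_n -> K) (x : 'I_n -> V),
    (forall i, X (x i)) /\ v = \sum_(i < n) c i *: x i].

Definition lin_indep n (b : 'I_n -> V) : Prop :=
  forall c : 'I_n -> K, \sum_(i < n) c i *: b i = 0 -> forall i, c i = 0.

Definition is_basis (S : set V) n (b : 'I_n -> V) : Prop :=
  lin_indep b /\ lin_span (range b) = S.

Definition has_dim (S : set V) (n : nat) : Prop :=
  exists b : 'I_n -> V, is_basis S b.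

Definition finite_dim (S : set V) : Prop := exists n, has_dim S n.

(* The set below is a singleton if the subspace S has a finite basis, and is
   empty otherwise, in which case its infimum is +oo. *)
Definition lin_dim (R : realType) (S : set V) : \bar R :=
  ereal_inf [set (n%:R)%:E | n in has_dim S].

End LinearAlgebra.

Section GKdim.
Variables (R : realType) (K : fieldType) (P : operad K).

Definition locally_finite : Prop := forall n, finite_dim [set: P n].

(* log_n x; the values at n = 0, 1 are junk, and log_n 0 = -oo for n >= 2. *)
Definition elog (n : nat) (x : \bar R) : \bar R :=
  (lne x * ((ln (n%:R : R))^-1)%:E)%E.

Definition GKdim_operad : \bar R :=
  limn_esup (fun n => elog n (\sum_(i < n.+1) lin_dim R [set: P i])%E).

Variables (A : lmodType K) (gamma : algebra_over P A).

(* The image of P(n) \otimes (K X)^{\otimes n}, which is spanned by the images of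
   the pure tensors. *)
Definition gamma_image (n : nat) (X : set A) : set A :=
  lin_span [set a | exists (t : P n) (x : 'I_n -> A),
    (forall i, lin_span X (x i)) /\ a = (gamma n t : multihom A n) x].

Definition gamma_sum (n : nat) (X : set A) : set A :=
  [set a | exists b : 'I_n.+1 -> A,
    (forall i : 'I_n.+1, gamma_image i X (b i)) /\ a = \sum_(i < n.+1) b i].

Definition is_generating (X : set A) : Prop :=
  \bigcup_n gamma_sum n X = [set: A].

Definition generated_by (g : nat) : Prop :=
  exists X : set A, (X #= `I_g)%card /\ is_generating X.

Definition GKdim_algebra : \bar R :=
  ereal_sup [set limn_esup (fun n => elog n (lin_dim R (gamma_sum n V))) |
             V in @finite_dim K A].

End GKdim.

(* Main.v *)
Require Import Defs.
From mathcomp Require Import all_boot all_order all_algebra all_fingroup.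
From mathcomp Require Import all_classical all_reals all_analysis.
From mathcomp Require Import zify lra.

(** The bound comes from comparing the filtration of [A] by an arbitrary finite
dimensional subspace [V] with the filtration by the generators.

Let [X] be a set of [g = h + 1] generators.  As [V] is finite dimensional, it
lies in some step [N] of the filtration by [X]; substituting elements of that
step into an operation of arity at most [n] and composing in [P] gives
operations of arity at most [n * N] evaluated on generators, so the step [n]
for [V] lies in the step [n * N] for [X] ([gamma_sum_subst]).

The symmetric groups make the steps for [X] small.  A value [t (x_w)] at a word
[w] in the generators equals [(t . s) (x_u)] where [u] is [w] sorted and [s] is
the sorting permutation.  Hence the values of arity [m] are spanned by the
values of a basis of [P m] at the nondecreasing words of length [m], of which
there are ['C(m + h, m) <= (m + 1) ^ h].  With [D n] the sum of the dimensions
of [P m] for [m <= n], the step [n] has dimension at most [D n * (n + 1) ^ h]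
([gamma_sum_dim]).

So the step [n] for [V] has dimension at most [D (n * N) * (n * N + 1) ^ h].
Taking [log_n], the second factor contributes [h = g - 1] in the limit, and the
first at most the growth exponent of [D], because [ln (n * N) / ln n] tends to
[1] ([limn_esup_elog_le]). *)

Set Implicit Arguments.
Unset Strict Implicit.
Unset Printing Implicit Defensive.

Import Order.TTheory GRing.Theory Num.Theory.
Local Open Scope ring_scope.
Local Open Scope classical_set_scope.

(** * Spans and dimensions *)

Section Subspaces.
Variables (K : fieldType) (V : lmodType K).
Implicit Types (S X : set V).

Definition lin_subspace S : Prop :=
  S 0 /\ forall a u v, S u -> S v -> S (a *: u + v).

Lemma lin_subspace_sum S (I : finType) (x : I -> V) :
  lin_subspace S -> (forall i, S (x i)) -> S (\sum_i x i).
Proof.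
move=> [S0 SD] Sx; elim/big_ind: _ => // u v Su Sv.
by rewrite -[u]scale1r; apply: SD.
Qed.

Lemma lin_subspace_lin_comb S (I : finType) (c : I -> K) (x : I -> V) :
  lin_subspace S -> (forall i, S (x i)) -> S (\sum_i c i *: x i).
Proof.
move=> sS Sx; apply: lin_subspace_sum => // i; rewrite -[X in S X]addr0.
by case: sS => S0; apply.
Qed.

Lemma lin_span_min S X : lin_subspace S -> X `<=` S -> lin_span X `<=` S.
Proof.
move=> sS XS v [n [c [x [Xx ->]]]].
by apply: lin_subspace_lin_comb => // i; apply/XS/Xx.
Qed.

Lemma sub_lin_span X : X `<=` lin_span X.
Proof.
by move=> v Xv; exists 1%N, (fun=> 1), (fun=> v); rewrite big_ord1 scale1r.
Qed.

Lemma lin_subspace_lin_span X : lin_subspace (lin_span X).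
Proof.
split.
  by exists 0%N, (fun=> 0), (fun=> 0); split=> [[]|]; rewrite ?big_ord0.
move=> a _ _ [m [c [x [Xx ->]]]] [n [d [y [Xy ->]]]].
exists (m + n)%N.
exists (fun i =>
  match fintype.split i with inl j => a * c j | inr j => d j end).
exists (fun i => match fintype.split i with inl j => x j | inr j => y j end).
split=> [i|]; first by case: (fintype.split i).
rewrite big_split_ord /= scaler_sumr; congr (_ + _); apply: eq_bigr => i _.
  by rewrite -[lshift n i]/(unsplit (inl i)) unsplitK scalerA.
by rewrite -[rshift m i]/(unsplit (inr i)) unsplitK.
Qed.

Lemma lin_span_mono X (Y : set V) : X `<=` Y -> lin_span X `<=` lin_span Y.
Proof.
move=> XY; apply: lin_span_min; first exact: lin_subspace_lin_span.
by move=> v /XY; apply: sub_lin_span.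
Qed.

(** The definition of a span allows repetitions in a combination; for the span
of a finite family each vector can be made to occur exactly once. *)
Lemma lin_span_rangeP (I : finType) (b : I -> V) v :
  lin_span (range b) v -> exists c : I -> K, v = \sum_i c i *: b i.
Proof.
move=> bv; pose T u := exists c : I -> K, u = \sum_i c i *: b i.
suff: lin_span (range b) `<=` T by apply.
apply: lin_span_min; first split.
- by exists (fun=> 0); rewrite big1 // => i _; rewrite scale0r.
- move=> a _ _ [c ->] [d ->]; exists (fun i => a * c i + d i).
  rewrite scaler_sumr -big_split; apply: eq_bigr => i _.
  by rewrite scalerDl scalerA.
- move=> _ [i _ <-]; exists (fun j => (j == i)%:R).
  rewrite (bigD1 i) //= eqxx scale1r big1 ?addr0 // => j /negbTE ->.
  by rewrite scale0r.
Qed.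

(** Steinitz's bound: the coordinates of [n] independent vectors on a family of
[#|I|] vectors form a matrix with no left kernel. *)
Lemma lin_indep_card (I : finType) (x : I -> V) n (b : 'I_n -> V) :
  lin_indep b -> (forall i, lin_span (range x) (b i)) -> (n <= #|I|)%N.
Proof.
move=> ib bx; have /choice[c cE] i := lin_span_rangeP (bx i).
pose B := \matrix_(i < n, j < #|I|) c i (enum_val j).
suff kB : kermx B = 0.
  have: row_free B by rewrite -kermx_eq0 kB.
  by move/eqP <-; apply: rank_leq_col.
apply/matrixP => r i; rewrite [RHS]mxE; apply: (ib (fun i => kermx B r i)).
under eq_bigr do rewrite cE scaler_sumr.
rewrite exchange_big big1 //= => j _.
under eq_bigr do rewrite scalerA.
rewrite -scaler_suml.
have /matrixP/(_ r (enum_rank j)) := mulmx_ker B.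
rewrite !mxE => kB0; rewrite [X in X *: _](_ : _ = 0) ?scale0r //.
by rewrite -[RHS]kB0; apply: eq_bigr => k _; rewrite !mxE enum_rankK.
Qed.

Lemma lin_indep_extend n (b : 'I_n -> V) v :
  lin_indep b -> ~ lin_span (range b) v ->
  lin_indep (fun i : 'I_n.+1 => oapp b v (unlift ord0 i)).
Proof.
move=> ib bv c; rewrite big_ord_recl unlift_none /=.
under eq_bigr do rewrite liftK /=.
have [c0|c0] := eqVneq (c ord0) 0.
  rewrite c0 scale0r add0r => /ib cb i.
  by case: (unliftP ord0 i) => [j|] ->.
(* The coefficient of [v] in a relation is invertible, so solve for [v]. *)
move=> E; case: bv.
have -> : v = \sum_i (- (c ord0)^-1 * c (lift ord0 i)) *: b i.
  under eq_bigr do rewrite -scalerA.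
  rewrite -scaler_sumr; move/(canRL (addKr _)): E; rewrite addr0 => ->.
  by rewrite scalerN scaleNr opprK scalerA mulVf // scale1r.
apply: lin_subspace_lin_comb; first exact: lin_subspace_lin_span.
by move=> i; apply: sub_lin_span; exists i.
Qed.

(** By Steinitz's bound there is a longest independent family in [S]; it spans
[S], for otherwise it could be extended. *)
Lemma has_dim_sub_span S (I : finType) (x : I -> V) :
  lin_subspace S -> S `<=` lin_span (range x) ->
  exists2 n, has_dim S n & (n <= #|I|)%N.
Proof.
move=> sS Sx.
pose Q n := `[< exists2 b : 'I_n -> V, lin_indep b & forall i, S (b i) >].
have Q0 : exists n, Q n.
  by exists 0%N; apply/asboolP; exists (fun=> 0) => [c _ []//|_]; case: sS.
have Qle n : Q n -> (n <= #|I|)%N.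
  by move=> /asboolP[b ib Sb]; apply: (lin_indep_card ib) => i; apply: Sx.
case: (ex_maxnP Q0 Qle) => n Qn nmax; exists n; last exact: Qle.
move/asboolP: Qn => [b ib Sb]; exists b; split=> //; apply/seteqP; split.
  by apply: lin_span_min => // _ [i _ <-].
move=> v Sv; apply: contrapT => bv.
suff /nmax : Q n.+1 by rewrite ltnn.
apply/asboolP; eexists; first exact: lin_indep_extend ib bv.
by move=> i /=; case: (unlift ord0 i) => [j|] /=.
Qed.

End Subspaces.

(** To place all values of [f] on products of spans in a subspace, it is enough
to look at values on generators: the spans can be reached one coordinate at a
time, each step being the minimality of a span. *)
Lemma multilinear_lin_span (K : fieldType) (I : finType) (V : I -> lmodType K)
    (W : lmodType K) (f : (forall i, V i) -> W) (Y : forall i, set (V i))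
    (T : set W) (x : forall i, V i) :
  multilinear f -> lin_subspace T ->
  (forall y, (forall i, Y i (y i)) -> T (f y)) ->
  (forall i, lin_span (Y i) (x i)) -> T (f x).
Proof.
move=> mf sT fY.
(* The coordinates in [s] range over spans, the others over generators. *)
suff H (s : seq I) : forall y, (forall i, i \notin s -> Y i (y i)) ->
    (forall i, lin_span (Y i) (y i)) -> T (f y).
  by apply: (H (enum I)) => i; rewrite mem_enum.
elim: s => [|i s IHs] {}x Yx sx; first by apply: fY => i; apply: Yx.
have -> : x = eqtype.dfwith x (x i).
  apply: functional_extensionality_dep => j.
  have [<-|ij] := eqVneq i j; first by rewrite eqtype.dfwith_in.
  by rewrite eqtype.dfwith_out.
pose S u := T (f (eqtype.dfwith x (u : V i))).
suff: lin_span (Y i) `<=` S by apply; apply: sx.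
apply: lin_span_min; first split.
- have := mf x i (-1) 0 0; rewrite scaler0 addr0 scaleN1r addNr /S => ->.
  by case: sT.
- by move=> a u v Su Sv; rewrite /S mf; case: sT => _; apply.
- move=> u Yu; apply: IHs => j; last first.
    have [<-|ij] := eqVneq i j.
      by rewrite eqtype.dfwith_in; apply: sub_lin_span.
    by rewrite eqtype.dfwith_out.
  have [<-|ij] := eqVneq i j; first by rewrite eqtype.dfwith_in.
  rewrite eqtype.dfwith_out // => js.
  by apply: Yx; rewrite inE negb_or eq_sym ij.
Qed.

(** The infimum defining [lin_dim] is over a set of natural numbers, so it is
attained. *)
Lemma lin_dim_min (R : realType) (K : fieldType) (V : lmodType K) (S : set V) :
  finite_dim S ->
  exists m, [/\ has_dim S m, lin_dim R S = (m%:R)%:E &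
               forall n, has_dim S n -> (m <= n)%N].
Proof.
move=> [n0 Sn0].
have ex : exists n, `[< has_dim S n >] by exists n0; apply/asboolP.
case: (ex_minnP ex) => m /asboolP Sm mmin.
have {}mmin n : has_dim S n -> (m <= n)%N by move=> Sn; apply/mmin/asboolP.
exists m; split=> //; apply/eqP; rewrite eq_le; apply/andP; split.
  by apply: ereal_inf_lbound; exists m.
by apply: le_ereal_inf_tmp => _ [n Sn <-]; rewrite lee_fin ler_nat mmin.
Qed.

(** * The filtration of an algebra by a subset *)

Section Filtration.
Variables (K : fieldType) (P : operad K) (A : lmodType K).
Variable gamma : algebra_over P A.

Definition op_values (n : nat) (X : set A) : set A :=
  [set a | exists (m : nat) (t : P m) (x : 'I_m -> A),
    [/\ (m <= n)%N, forall i, X (x i) &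
        a = (gamma m t : multihom A m) x]].

Lemma lin_subspace_gamma_image n X : lin_subspace (gamma_image gamma n X).
Proof. exact: lin_subspace_lin_span. Qed.

Lemma gamma_image_sub_span m n X : (m <= n)%N ->
  gamma_image gamma m X `<=` lin_span (op_values n X).
Proof.
move=> mn; apply: lin_span_min; first exact: lin_subspace_lin_span.
move=> _ [t [x [Xx ->]]].
apply: (multilinear_lin_span (multihom_linear (gamma m t : multihom A m))
         (lin_subspace_lin_span _) _ Xx) => y Xy.
by apply: sub_lin_span; exists m, t, y.
Qed.

Lemma lin_subspace_gamma_sum n X : lin_subspace (gamma_sum gamma n X).
Proof.
split.
  exists (fun=> 0); split; last by rewrite big1.
  by move=> i; case: (lin_subspace_gamma_image i X).
move=> a _ _ [b [Xb ->]] [c [Xc ->]]; exists (fun i => a *: b i + c i); split.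
  by move=> i; case: (lin_subspace_gamma_image i X) => _;
    apply; [exact: Xb|exact: Xc].
by rewrite scaler_sumr -big_split.
Qed.

Lemma gamma_image_sub_sum m n X : (m <= n)%N ->
  gamma_image gamma m X `<=` gamma_sum gamma n X.
Proof.
move=> mn a Xa; have mn1 : (m < n.+1)%N by [].
exists (fun i : 'I_n.+1 => if i == Ordinal mn1 then a else 0); split.
  move=> i; case: eqP => [->//|_].
  by case: (lin_subspace_gamma_image i X).
by rewrite -big_mkcond big_pred1_eq.
Qed.

(** This spanning set mentions neither the span of [X] nor a decomposition into
arities, which makes minimality of spans applicable to [gamma_sum]. *)
Lemma gamma_sumE n X : gamma_sum gamma n X = lin_span (op_values n X).
Proof.
apply/seteqP; split.
  move=> _ [b [Xb ->]]; apply: lin_subspace_sum.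
    exact: lin_subspace_lin_span.
  by move=> i; apply/gamma_image_sub_span/Xb; rewrite -ltnS.
apply: lin_span_min; first exact: lin_subspace_gamma_sum.
move=> _ [m [t [x [mn Xx ->]]]]; apply: (gamma_image_sub_sum mn).
by apply: sub_lin_span; exists t, x; split=> // i; apply/sub_lin_span/Xx.
Qed.

Lemma gamma_sum_mono m n X : (m <= n)%N ->
  gamma_sum gamma m X `<=` gamma_sum gamma n X.
Proof.
move=> mn; rewrite !gamma_sumE; apply: lin_span_mono.
by move=> _ [k [t [x [km Xx ->]]]]; exists k, t, x; rewrite (leq_trans km).
Qed.

(** By multilinearity it is enough to substitute, into an operation of arity at
most [n], values of operations of arity at most [N]; as [gamma] is an operad
morphism, this evaluates a composite, whose arity is at most [n * N]. *)
Lemma gamma_sum_subst n N X (V : set A) :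
  V `<=` gamma_sum gamma N X ->
  gamma_sum gamma n V `<=` gamma_sum gamma (n * N) X.
Proof.
rewrite !gamma_sumE => VX.
apply: lin_span_min; first exact: lin_subspace_lin_span.
move=> _ [m [t [x [mn Vx ->]]]].
apply: (multilinear_lin_span (multihom_linear (gamma m t : multihom A m))
  (lin_subspace_lin_span _) (Y := fun=> op_values N X)) => [y Xy|i];
  last exact/VX/Vx.
pose word := {k : nat & (P k * ('I_k -> A))%type}.
have /choice[w wP] i : exists w : word,
    [/\ (tag w <= N)%N, forall j, X ((tagged w).2 j) &
        y i = (gamma (tag w) (tagged w).1 : multihom A (tag w)) (tagged w).2].
  by have [k [s [z ?]]] := Xy i; exists (existT _ k (s, z)).
apply: sub_lin_span.
exists _, (op_comp (k := fun i => tag (w i)) t (fun i => (tagged (w i)).1)).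
exists (fun u => (tagged (w (tagnat.sig1 u))).2 (tagnat.sig2 u)).
split=> [|u|].
- rewrite (leq_trans _ (leq_mul mn (leqnn N))) //.
  have -> : (m * N = \sum_(i < m) N)%N by rewrite sum_nat_const card_ord.
  by apply: leq_sum => i _; case: (wP i).
- by case: (wP (tagnat.sig1 u)).
- rewrite hom_comp /=; congr (_ _); apply: funext => i.
  case: (wP i) => _ _ ->; congr (_ _); apply: funext => j.
  by rewrite /tagnat.sig1 /tagnat.sig2 /tagnat.Rank tagnat.rankK.
Qed.

End Filtration.

(** The filtration by generators is exhaustive and increasing, so it swallows a
finite basis at some step.  A positive step is what makes [log_(n * N)]
comparable with [log_n]. *)
Lemma finite_dim_sub_gamma_sum (K : fieldType) (P : operad K) (A : lmodType K)
    (gamma : algebra_over P A) (X V : set A) :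
  is_generating gamma X -> finite_dim V ->
  exists2 N, (0 < N)%N & V `<=` gamma_sum gamma N X.
Proof.
move=> genX [n [b [_ <-]]].
have /choice[N NP] i : exists N, gamma_sum gamma N X (b i).
  by have : [set: A] (b i) by []; rewrite -genX => -[N _ ?]; exists N.
exists (\max_i N i).+1 => //.
apply: lin_span_min; first exact: lin_subspace_gamma_sum.
move=> _ [i _ <-]; apply: gamma_sum_mono (NP i).
by apply: leqW; exact: leq_bigmax.
Qed.

(** * Counting values on generators *)

Lemma bin_addn_leq_expn m h : ('C(m + h, m) <= m.+1 ^ h)%N.
Proof.
suff H : ('C(m + h, h) <= m.+1 ^ h)%N by rewrite -bin_sub ?leq_addr // addKn.
elim: h => [|h IHh]; first by rewrite bin0.
rewrite -(leq_pmul2l (ltn0Sn h)) -mul_bin_diag addnS /= expnS mulnA.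
by apply: leq_mul => //; nia.
Qed.

(** The entry of [w] at [i] sits at [s i] in its sorted version [u], so that
[u \o s = w]: the form in which the right action moves [s] to the operation. *)
Lemma perm_sorted_word m h (w : 'I_m -> 'I_h.+1) :
  exists2 u : m.-tuple 'I_h.+1, sorted leq (map val u) &
    exists s : 'S_m, forall i, w i = tnth u (s i).
Proof.
pose r : rel 'I_h.+1 := relpre val leq.
exists (sort_tuple r [tuple w i | i < m]).
  rewrite sorted_map; apply: sort_sorted => i j; exact: leq_total.
have /tuple_permP[s E] : perm_eq [tuple w i | i < m]
    (sort_tuple r [tuple w i | i < m]).
  by rewrite perm_sym perm_sort.
exists s => i; have := congr1 (fun q => nth ord0 q i) E.
by rewrite -!tnth_nth !tnth_mktuple.
Qed.

Section Counting.
Variables (K : fieldType) (P : operad K) (A : lmodType K).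
Variable gamma : algebra_over P A.

Lemma lin_subspace_eval m (x : 'I_m -> A) (T : set A) : lin_subspace T ->
  lin_subspace [set t : P m | T ((gamma m t : multihom A m) x)].
Proof.
move=> [T0 TD]; split=> [|a u v Tu Tv] /=.
  by rewrite linear0.
by rewrite linearP /=; apply: TD.
Qed.

(** A spanning family is indexed by an arity [m <= n], a basis element of [P m]
and a nondecreasing word of length [m] in the generators. *)
Lemma gamma_sum_dim (d : nat -> nat) n h (e : 'I_h.+1 -> A) :
  (forall m, has_dim [set: P m] (d m)) ->
  exists2 N, has_dim (gamma_sum gamma n (range e)) N &
    (N <= (\sum_(m < n.+1) d m) * n.+1 ^ h)%N.
Proof.
move=> dP; have expn_mono m : (m < n.+1)%N -> (m.+1 ^ h <= n.+1 ^ h)%N.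
  by case: h {e} => // h; rewrite leq_exp2r.
pose b m : 'I_(d m) -> P m := sval (cid (dP m)).
have bP m : is_basis [set: P m] (b m) := svalP (cid (dP m)).
pose sorted_word m := {u : m.-tuple 'I_h.+1 | sorted leq (map val u)}.
pose I := {m : 'I_n.+1 & ('I_(d m) * sorted_word m)%type}.
pose F (q : I) : A := (gamma (tag q) (b _ (tagged q).1) : multihom A (tag q))
  (fun j => e (tnth (val (tagged q).2) j)).
have cardI : (#|{: I}| <= (\sum_(m < n.+1) d m) * n.+1 ^ h)%N.
  rewrite card_tagged sumnE big_map big_enum /= big_distrl /=.
  apply: leq_sum => m _; rewrite card_prod card_ord leq_mul2l card_sig.
  rewrite -[X in (X <= _)%N]cardsE card_sorted_tuples.
  rewrite (leq_trans (bin_addn_leq_expn _ _)) ?orbT //; exact/expn_mono/ltn_ord.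
suff: gamma_sum gamma n (range e) `<=` lin_span (range F).
  move/(has_dim_sub_span (lin_subspace_gamma_sum _ _ _)) => [N dN NI].
  by exists N => //; apply: leq_trans NI _.
rewrite gamma_sumE; apply: lin_span_min; first exact: lin_subspace_lin_span.
move=> _ [m [t [x [mn ex ->]]]].
have /choice[w wE] i : exists j, x i = e j by case: (ex i) => j _ <-; exists j.
have [u u_sorted [s ws]] := perm_sorted_word w.
(* The sorting permutation passes from the word to the operation. *)
have -> : x = (fun i => e (tnth u (s i))) by apply: funext => i; rewrite wE ws.
have -> : (gamma m t : multihom A m) (fun i => e (tnth u (s i))) =
    (gamma m (op_act t s) : multihom A m) (fun i => e (tnth u i)).
  by rewrite hom_act.
have sE := lin_subspace_eval (fun i => e (tnth u i))
  (lin_subspace_lin_span (range F)).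
have bts : lin_span (range (b m)) (op_act t s) by case: (bP m) => _ ->.
apply: (lin_span_min sE _ bts) => _ [i _ <-] /=; apply: sub_lin_span.
have mn1 : (m < n.+1)%N by [].
by exists (existT _ (Ordinal mn1) (i, exist _ u u_sorted)).
Qed.

End Counting.

(** * Growth exponents *)

Section LimSup.
Variable R : realType.
Implicit Types (u : nat -> \bar R).
Local Open Scope ereal_scope.

Lemma limn_esup_le_eventually u (x : \bar R) M :
  (forall n, (M <= n)%N -> u n <= x) -> limn_esup u <= x.
Proof.
move=> ux; apply: (@le_trans _ _ (ereal_sup (u @` [set n | (M <= n)%N]))).
  by apply: ereal_inf_lbound; exists [set n | (M <= n)%N] => //; exists M.
by apply: ge_ereal_sup => _ [n Mn <-]; apply: ux.
Qed.

Lemma limn_esup_lt_eventually u (x : \bar R) :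
  limn_esup u < x -> exists M, forall n, (M <= n)%N -> u n <= x.
Proof.
move=> /ereal_inf_lt[_ [B [M _ MB] <-] Bx]; exists M => n Mn.
by apply: le_trans (ltW Bx); apply: ereal_sup_ubound; exists n => //; apply: MB.
Qed.

Lemma elog_nat n m : (1 < n)%N -> (0 < m)%N ->
  elog n (m%:R : R)%:E = (ln m%:R / ln n%:R)%:E.
Proof. by move=> n1 m0; rewrite /elog lne_EFin ?ltr0n. Qed.

Lemma elog_nat0 n : (1 < n)%N -> elog n (0%N%:R : R)%:E = -oo.
Proof.
move=> n1; rewrite /elog le0_lneNy // gt0_mulNye // lte_fin invr_gt0.
by rewrite ln_gt0 // ltr1n.
Qed.

(** For a real [l] above the growth exponent of [D], eventually
[ln (D (n * N)) <= l * (ln n + ln N)] as soon as [D (n * N) != 0], whence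
[ln (a n) <= (h + l) * ln n + c] with [c] independent of [n].  Letting [l]
decrease gives the bound for an exponent that is finite or [-oo], and there is
nothing to prove for [+oo]; [a n = 0] is harmless, the logarithm being then
[-oo]. *)
Lemma limn_esup_elog_le (a D : nat -> nat) h N : (0 < N)%N ->
  (forall n, (a n <= D (n * N) * (n * N).+1 ^ h)%N) ->
  limn_esup (fun n => elog n ((a n)%:R : R)%:E) <=
  (h%:R)%:E + limn_esup (fun n => elog n ((D n)%:R : R)%:E).
Proof.
move=> N0 aD; set u := fun n => _; set v := fun n => _.
have key (l : R) : limn_esup v < l%:E -> limn_esup u <= (h%:R + l)%:E.
  move=> /limn_esup_lt_eventually[M vM].
  apply/lee_addgt0Pr => eps eps0.
  pose c : R := (h%:R * ln N.+1%:R + l * ln N%:R)%R.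
  (* From this rank on, [c / ln n <= eps]. *)
  pose M' := Num.bound (expR (c / eps)).
  apply: (@limn_esup_le_eventually _ _ (maxn 2 (maxn M M'))) => n.
  rewrite !geq_max => /and3P[n2 Mn M'n].
  have [a0|a0] := posnP (a n); first by rewrite /u a0 elog_nat0 // leNye.
  have D0 : (0 < D (n * N))%N.
    by have := leq_trans a0 (aD n); rewrite muln_gt0 => /andP[].
  have nN2 : (1 < n * N)%N by nia.
  have ln_n : (0 < ln (n%:R : R))%R by rewrite ln_gt0 // ltr1n.
  have := vM _ (leq_trans Mn (leq_pmulr n N0)).
  rewrite /v elog_nat // lee_fin ler_pdivrMr ?ln_gt0 ?ltr1n // => lnD.
  rewrite /u elog_nat // -EFinD lee_fin ler_pdivrMr //.
  have lna : (ln ((a n)%:R : R) <=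
      ln (D (n * N)%N)%:R + h%:R * ln (n * N)%N.+1%:R)%R.
    apply: (@le_trans _ _ (ln (D (n * N) * (n * N).+1 ^ h)%N%:R)).
      by rewrite ler_ln ?posrE ?ltr0n ?ler_nat ?aD // muln_gt0 D0 expn_gt0.
    rewrite natrM lnM ?posrE ?ltr0n ?expn_gt0 // natrX lnXn ?ltr0n //.
    by rewrite mulr_natl.
  have lnS : (ln ((n * N)%N.+1%:R : R) <= ln n%:R + ln N.+1%:R)%R.
    rewrite -lnM ?posrE ?ltr0n //; last by lia.
    by rewrite -natrM ler_ln ?posrE ?ltr0n ?ler_nat //; nia.
  have lnM' : ln ((n * N)%N%:R : R) = (ln n%:R + ln N%:R)%R.
    by rewrite natrM lnM ?posrE ?ltr0n //; lia.
  have cn : (c <= eps * ln n%:R)%R.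
    rewrite mulrC -ler_pdivrMr // -[leLHS]expRK.
    rewrite ler_ln ?posrE ?expR_gt0 ?ltr0n //; last by lia.
    by rewrite ltW // (lt_le_trans (archi_boundP (expR_ge0 _))) // ler_nat.
  have := ler_wpM2l (ler0n R h) lnS.
  rewrite lnM' in lnD; rewrite /c in cn; lra.
case E: (limn_esup v) => [r| |]; last first.
- suff -> : limn_esup u = -oo by rewrite leNye.
  case: (limn_esup u) key => // [r|] key.
  + have := key (r - h%:R - 1)%R; rewrite E ltNyr lee_fin => /(_ isT) rh.
    by exfalso; move: rh {key E}; lra.
  + by have := key 0%R; rewrite E ltNyr leye_eq => /(_ isT).
- by rewrite addey // leey.
- apply/lee_addgt0Pr => eps eps0; rewrite -!EFinD -addrA; apply: key.
  by rewrite E lte_fin ltrDl.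
Qed.

End LimSup.

(** * The inequality *)

Lemma card_eq_range (T : Type) (X : set T) g :
  (X #= `I_g)%card -> exists e : 'I_g -> T, X = range e.
Proof.
move=> /card_set_bijP[f [fX f_inj f_surj]].
have /choice[e eP] (i : 'I_g) : exists x, X x /\ f x = i.
  by have [x Xx fx] := f_surj i (ltn_ord i); exists x.
exists e; apply/seteqP; split=> [x Xx|_ [i _ <-]]; last by case: (eP i).
exists (Ordinal (fX x Xx)) => //; case: (eP (Ordinal (fX x Xx))) => Xe fe.
by apply: f_inj; rewrite ?inE.
Qed.

Theorem theorem0p9 (R : realType) (K : fieldType) (P : operad K)
    (A : lmodType K) (gamma : algebra_over P A) (g : nat)
    (Pfin : locally_finite P) (g_gt0 : (0 < g)%N)
    (Agen : generated_by gamma g) :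
  (GKdim_algebra R gamma <= (g%:R - 1)%:E + GKdim_operad R P)%E.
Proof.
case: g g_gt0 Agen => // h _ [X [/card_eq_range[e Xe] genX]]; subst X.
have /choice[d dP] m := @lin_dim_min R _ _ _ (Pfin m).
apply: ge_ereal_sup => _ [V /(finite_dim_sub_gamma_sum genX)[N N0 VN] <-].
have /choice[a aP] n : exists a,
    lin_dim R (gamma_sum gamma n V) = (a%:R)%:E /\
    (a <= (\sum_(m < (n * N).+1) d m) * (n * N).+1 ^ h)%N.
  have dimP m : has_dim [set: P m] (d m) by case: (dP m).
  have [M [b [_ bM]] leM] := gamma_sum_dim gamma (n * N) e dimP.
  have := @gamma_sum_subst _ _ _ gamma n N _ _ VN; rewrite -bM.
  move=> /(has_dim_sub_span (lin_subspace_gamma_sum gamma n V))[M' dM' M'M].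
  have [a [_ aE amin]] := @lin_dim_min R _ _ _ (ex_intro _ M' dM').
  exists a; split=> //; apply: leq_trans leM; apply: leq_trans (amin _ dM') _.
  by rewrite card_ord in M'M.
rewrite (_ : (fun n => _) = fun n => elog n ((a n)%:R)%:E); last first.
  by apply: funext => n; case: (aP n) => ->.
rewrite /GKdim_operad (_ : (fun n => elog n (\sum_(i < n.+1) _)%E) =
    fun n => elog n ((\sum_(i < n.+1) d i)%N%:R)%:E); last first.
  apply: funext => n; congr elog; rewrite natr_sum -sumEFin.
  by apply: eq_bigr => i _; case: (dP i).
rewrite -natr1 addrK.
have aD n := (aP n).2.
exact (@limn_esup_elog_le R a (fun n => \sum_(i < n.+1) d i)%N h N N0 aD).
Qed.
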